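(* Let $X, Y \in \mathbb{C}^{n\times m}$, let $F \in \mathbb{C}^{n\times n}$ be the unitary matrix with entries $F_{j,k} = e^{2\pi i (j-1)(k-1)/n}/\sqrt{n}$, and let $\mathcal{X} = F^* X$, $\mathcal{Y} = F^* Y$, with $j$-th rows $\tilde{\mathcal{X}}_j, \tilde{\mathcal{Y}}_j \in \mathbb{C}^{1\times m}$. Consider minimizing $\|Y - AX\|_F$ over circulant matrices $A = F\,\mathrm{diag}(\hat a_1,\dots,\hat a_n)\,F^*$ subject to an additional constraint. (1) Suppose $\tilde{\mathcal{X}}_j \ne 0$ for all $j$. Over circulant $A$ that are symmetric ($A = A^*$), the optimal eigenvalues are $\hat a_j = \mathrm{Re}\big[\tilde{\mathcal{Y}}_j\tilde{\mathcal{X}}_j^*\big]/\|\tilde{\mathcal{X}}_j\|_2^2$ for $1\le j\le n$. (2) Suppose $\tilde{\mathcal{X}}_j \ne 0$ for all $j$. Over circulant $A$ that are skew-symmetric ($A = -A^*$), the optimal eigenvalues are $\hat a_j = i\,\mathrm{Im}\big[\tilde{\mathcal{Y}}_j\tilde{\mathcal{X}}_j^*\big]/\|\tilde{\mathcal{X}}_j\|_2^2$ for $1\le j\le n$. (3) Suppose $\tilde{\mathcal{Y}}_j\tilde{\mathcal{X}}_j^* \neq 0$ for all $j$. Over circulant $A$ that are unitary, the optimal eigenvalues are $\hat a_j = \tilde{\mathcal{Y}}_j\tilde{\mathcal{X}}_j^*/|\tilde{\mathcal{Y}}_j\tilde{\mathcal{X}}_j^*|$ for $1\le j\le n$.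
   Context: A matrix $A\in\mathbb{C}^{n\times n}$ is circulant if there are $a_0,\dots,a_{n-1}\in\mathbb{C}$ with $A_{j,k} = a_{(j-k) \bmod n}$ for all $j,k$; every such matrix has the form $F\,\mathrm{diag}(\hat a_1,\dots,\hat a_n)\,F^*$ with the $F$ given in the claim. $\|\cdot\|_F$ is the Frobenius norm and $*$ denotes conjugate transpose. In this setting ''symmetric'' means Hermitian, $A=A^*$ (equivalently, for circulant $A$, real eigenvalues), and ''skew-symmetric'' means $A=-A^*$ (purely imaginary eigenvalues). *)

(* Defs.v *)
From HB Require Import structures.
From mathcomp Require Import all_boot all_order all_algebra.
From mathcomp Require Import complex.
From mathcomp Require Import reals trigo.

Set Implicit Arguments.
Unset Strict Implicit.
Unset Printing Implicit Defensive.

Import Order.TTheory GRing.Theory Num.Theory.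
Local Open Scope ring_scope.

(* j - k mod n is written (j + (n - k)) %% n, because subtraction on nat is
   truncated; here k < n. *)
Definition circulant (C : nmodType) (n : nat) (A : 'M[C]_n) : Prop :=
  exists a : n.-tuple C,
    forall j k : 'I_n, A j k = nth 0 a ((j + (n - k)) %% n)%N.

(* A nonnegative real element of C, so that the partial order of C is the
   usual order on its values. On row vectors this is the 2-norm. *)
Definition frobenius_norm (C : numClosedFieldType) (n m : nat)
    (A : 'M[C]_(n, m)) : C :=
  sqrtC (\sum_i \sum_j `|A i j| ^+ 2).

Definition cis (R : realType) (t : R) : R[i] := (cos t +i* sin t)%C.

(* Indices start from 0, whence j * k instead of (j - 1) * (k - 1). *)
Definition dft_mx (R : realType) (n : nat) : 'M[R[i]]_n :=
  \matrix_(j, k) (cis (2%:R * pi * (j * k)%:R / n%:R) / sqrtC n%:R).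

Definition is_minimizer (T : Type) (C : numDomainType)
    (P : T -> Prop) (f : T -> C) (x : T) : Prop :=
  P x /\ forall y, P y -> f x <= f y.

(* Main.v *)
(** The columns of [F] are orthonormal eigenvectors common to all circulant
    matrices, so the problem decouples: for [A = F diag(d) F^*], the squared
    objective is the sum over the rows [j] of [||y_j - d_j x_j||^2].  In each of
    the three cases the feasible [d_j] range over a fixed set of scalars (the
    real line, the imaginary line, the unit circle), and on that set completing
    the square gives
      [||y_j - d_j x_j||^2 = ||y_j - c_j x_j||^2 + w_j |d_j - c_j|^2],
    where [c_j] is the claimed optimum and [w_j > 0]; here [w_j = ||x_j||^2] for
    the two lines and [w_j = |y_j x_j^*|] for the circle. *)
Require Import Defs.
From HB Require Import structures.
From mathcomp Require Import all_boot all_order all_algebra.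
From mathcomp Require Import sesquilinear spectral.
From mathcomp Require Import complex.
From mathcomp Require Import reals trigo.
From mathcomp Require Import ring lra.

Set Implicit Arguments.
Unset Strict Implicit.
Unset Printing Implicit Defensive.

Import Order.TTheory GRing.Theory Num.Theory.
Local Open Scope ring_scope.
Local Open Scope sesquilinear_scope.

(** * Fourier matrices built from a primitive root of unity *)

Lemma conjC_unity_root (C : numClosedFieldType) (z : C) n :
  (0 < n)%N -> z ^+ n = 1 -> z^* = z^-1.
Proof.
move=> n0 zn; have nz : `|z| = 1.
  apply/eqP; rewrite -(@pexpr_eq1 _ _ n) ?normr_ge0 //.
  by rewrite -normrX zn normr1.
by rewrite invC_norm nz expr1n invr1 mul1r.
Qed.

Section PrimitiveRootDFT.
Variables (C : numClosedFieldType) (n : nat) (z : C).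
Hypothesis prim_z : n.-primitive_root z.

(** Stated for any primitive root [z], so that diagonalizing circulant matrices is pure algebra;
    trigonometry enters only when [z] is specialized to [cis]. *)
Definition root_dft_mx : 'M[C]_n := \matrix_(j, k) (z ^+ (j * k) / sqrtC n%:R).
Local Notation F := root_dft_mx.

Let n_gt0 : (0 < n)%N. Proof. exact: prim_order_gt0 prim_z. Qed.
Let z_neq0 : z != 0.
Proof. by rewrite (prim_root_eq0 prim_z) -lt0n. Qed.
Let conj_z : z^* = z^-1.
Proof. exact: conjC_unity_root n_gt0 (prim_expr_order prim_z). Qed.
Let sqrt_n_neq0 : sqrtC n%:R != 0 :> C.
Proof. by rewrite sqrtC_eq0 pnatr_eq0 -lt0n. Qed.
Let conj_sqrt_n : (sqrtC n%:R)^* = sqrtC n%:R :> C.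
Proof. by apply/CrealP; rewrite realE sqrtC_ge0 ler0n. Qed.

(** A geometric sum of ratio [x = z ^+ j / z ^+ l]. For [j != l], primitivity gives [x != 1], and
    multiplying the sum by [x - 1] yields [x ^+ n - 1 = 0]. *)
Lemma sum_prim_root_expr (j l : 'I_n) :
  \sum_(k < n) z ^+ (j * k) / z ^+ (l * k) = n%:R *+ (j == l).
Proof.
set x := z ^+ j / z ^+ l.
have xk k : z ^+ (j * k) / z ^+ (l * k) = x ^+ k.
  by rewrite /x expr_div_n !exprM.
under eq_bigr do rewrite xk.
have [jl|jl] := eqVneq j l.
  under eq_bigr do rewrite /x jl divff ?expf_neq0 // expr1n.
  by rewrite sumr_const card_ord.
have x1 : x - 1 != 0.
  rewrite subr_eq0; apply: contra jl => /eqP x1.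
  have /eqP : z ^+ j = z ^+ l.
    by rewrite -[z ^+ l]mul1r -x1 /x divfK ?expf_neq0.
  by rewrite (eq_prim_root_expr prim_z) !modn_small.
apply: (mulfI x1); rewrite -subrX1 mulr0 /x expr_div_n -!exprM.
by rewrite ![(_ * n)%N]mulnC !exprM !(prim_expr_order prim_z) !expr1n divr1 subrr.
Qed.

Lemma root_dft_mx_unitary : F \is unitarymx.
Proof.
apply/unitarymxP/matrixP=> j l; rewrite !mxE.
transitivity ((\sum_(k < n) z ^+ (j * k) / z ^+ (l * k)) / n%:R).
  rewrite mulr_suml; apply: eq_bigr => k _; rewrite !mxE.
  rewrite rmorphM fmorphV /= rmorphXn /= conj_sqrt_n conj_z exprVn.
  by rewrite mulrACA -invfM -expr2 sqrtCK.
by rewrite sum_prim_root_expr; case: eqP => _; rewrite ?mul0r // divff // pnatr_eq0 -lt0n.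
Qed.

(** Conjugation inverts [z], so the [l]-th term of the entry involves [j] and [k] only through
    [(z ^+ j / z ^+ k) ^+ l], hence only through [j - k] modulo [n]. *)
Lemma root_dft_mx_diag (d : 'rV[C]_n) (j k i : 'I_n) :
  i = ((j + (n - k)) %% n)%N :> nat ->
  (F *m diag_mx d *m F^t*) j k = (F *m d^T) i 0 / sqrtC n%:R.
Proof.
move=> ijk; rewrite !mxE mulr_suml; apply: eq_bigr => l _.
rewrite mul_mx_diag !mxE rmorphM fmorphV /= rmorphXn /= conj_sqrt_n conj_z exprVn.
(* Since [k < n], the truncated [n - k] is exact, and [z ^+ n = 1] makes [z ^+ (n - k)] the inverse
   of [z ^+ k]. *)
have -> : z ^+ (i * l) = z ^+ (j * l) / z ^+ (k * l).
  rewrite !exprM ijk (prim_expr_mod prim_z) exprD -expr_div_n; congr ((_ * _) ^+ l).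
  apply: (mulIf (expf_neq0 k z_neq0)); rewrite mulVf ?expf_neq0 //.
  by rewrite -exprD subnK ?(prim_expr_order prim_z) // ltnW.
have := expf_neq0 (k * l)%N z_neq0; move: (z ^+ _) (z ^+ (j * l)) => u v u0.
by field; rewrite sqrt_n_neq0.
Qed.

Lemma circulant_root_dft_mx (A : 'M[C]_n) :
  circulant A <-> exists d : 'rV[C]_n, A = F *m diag_mx d *m F^t*.
Proof.
have lt_mod (j k : 'I_n) : ((j + (n - k)) %% n < n)%N by rewrite ltn_pmod.
split=> [[a Aa]|[d ->]]; last first.
  exists [tuple (F *m d^T) i 0 / sqrtC n%:R | i < n] => j k.
  rewrite (root_dft_mx_diag d (i := Ordinal (lt_mod j k))) //.
  by rewrite -[(_ %% _)%N]/(val (Ordinal (lt_mod j k))) -tnth_nth tnth_mktuple.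
(* The eigenvalues solve [F *m d^T = sqrtC n%:R *: c], where [c] is the first column of [A];
   unitarity of [F] inverts this system. *)
pose c : 'cV[C]_n := \col_i tnth a i.
exists (sqrtC n%:R *: (F^t* *m c))^T; apply/matrixP=> j k.
rewrite (root_dft_mx_diag _ (i := Ordinal (lt_mod j k))) // trmxK.
rewrite -scalemxAr mulmxA (unitarymxP root_dft_mx_unitary) mul1mx !mxE.
by rewrite mulrC mulKf // Aa (tnth_nth 0).
Qed.

End PrimitiveRootDFT.

(** * Least squares over matrices diagonalized by a fixed unitary matrix *)

Section UnitarilyDiagonalLeastSquares.
Variables (C : numClosedFieldType) (n m : nat).

Lemma frobenius_norm_ge0 p (M : 'M[C]_(p, m)) : 0 <= frobenius_norm M.
Proof.
by rewrite sqrtC_ge0 !sumr_ge0 // => i _; rewrite sumr_ge0 // => j _; rewrite exprn_ge0.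
Qed.

Lemma frobenius_norm_sqr p (M : 'M[C]_(p, m)) :
  frobenius_norm M ^+ 2 = \sum_i \sum_j `|M i j| ^+ 2.
Proof. exact: sqrtCK. Qed.

Lemma frobenius_norm_tr p (M : 'M[C]_(p, m)) :
  frobenius_norm M ^+ 2 = \tr (M^t* *m M).
Proof.
rewrite frobenius_norm_sqr exchange_big; apply: eq_bigr => j _; rewrite mxE.
by apply: eq_bigr => i _; rewrite !mxE normCKC.
Qed.

Lemma frobenius_norm_row p (M : 'M[C]_(p, m)) :
  frobenius_norm M ^+ 2 = \sum_i frobenius_norm (row i M) ^+ 2.
Proof.
rewrite frobenius_norm_sqr; apply: eq_bigr => i _.
rewrite frobenius_norm_sqr big_ord1; apply: eq_bigr => j _; by rewrite mxE.
Qed.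

Lemma frobenius_norm_row_gt0 (u : 'rV[C]_m) :
  u != 0 -> 0 < frobenius_norm u ^+ 2.
Proof.
move=> u0; rewrite lt0r exprn_ge0 ?frobenius_norm_ge0 // andbT.
apply: contra u0; rewrite frobenius_norm_sqr big_ord1 psumr_eq0 => [|j _]; last first.
  by rewrite exprn_ge0.
move=> /allP u0; apply/eqP/rowP=> j; rewrite mxE.
by have := u0 j (mem_index_enum j); rewrite /= expf_eq0 normr_eq0 => /eqP.
Qed.

Lemma frobenius_norm_subZ (u v : 'rV[C]_m) (a : C) :
  let s := (u *m v^t*) 0 0 in
  frobenius_norm (u - a *: v) ^+ 2 =
    frobenius_norm u ^+ 2 - (a^* * s + a * s^*)
      + a * a^* * frobenius_norm v ^+ 2.
Proof.
move=> s; rewrite !frobenius_norm_sqr !big_ord1 {}/s mxE rmorph_sum /=.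
rewrite !mulr_sumr -big_split -sumrB -big_split; apply: eq_bigr => k _ /=.
by rewrite !mxE !normCK !rmorphB !rmorphM /= !conjCK; ring.
Qed.

Variables (F : 'M[C]_n) (X Y : 'M[C]_(n, m)).
Hypothesis unitary_F : F \is unitarymx.
Local Notation XX := (F^t* *m X).
Local Notation YY := (F^t* *m Y).
Local Notation obj A := (frobenius_norm (Y - A *m X)).

Let tC_F : F^t* *m F = 1%:M.
Proof. by rewrite -invmx_unitary // mulVmx ?unitarymx_unit. Qed.

Lemma frobenius_norm_unitarymx (M : 'M[C]_(n, m)) :
  frobenius_norm (F *m M) ^+ 2 = frobenius_norm M ^+ 2.
Proof.
rewrite !frobenius_norm_tr trmx_mul map_mxM mulmxA.
by rewrite -[_ *m F]mulmxA tC_F mulmx1.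
Qed.

Lemma obj_unitary_diag (d : 'rV[C]_n) :
  obj (F *m diag_mx d *m F^t*) ^+ 2 =
    \sum_j frobenius_norm (row j YY - d 0 j *: row j XX) ^+ 2.
Proof.
have -> : Y - F *m diag_mx d *m F^t* *m X = F *m (YY - diag_mx d *m XX).
  by rewrite mulmxBr !mulmxA (unitarymxP unitary_F) mul1mx.
rewrite frobenius_norm_unitarymx frobenius_norm_row; apply: eq_bigr => j _.
by congr (frobenius_norm _ ^+ 2); apply/rowP=> k; rewrite mul_diag_mx !mxE.
Qed.

(** The step shared by the three cases: [P] is the set of admissible eigenvalues. Summing the
    residual identity over the rows writes the excess of the squared objective over its value at [c]
    as a weighted sum of squares, which gives optimality; positive weights give uniqueness. *)
Lemma is_minimizer_unitary_diag (P : C -> Prop) (Q : 'M[C]_n -> Prop)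
    (c : 'rV[C]_n) (w : 'I_n -> C) :
  (forall A, Q A <->
     exists2 d : 'rV[C]_n, forall j, P (d 0 j) & A = F *m diag_mx d *m F^t*) ->
  (forall j, P (c 0 j)) ->
  (forall j, 0 < w j) ->
  (forall j a, P a ->
     frobenius_norm (row j YY - a *: row j XX) ^+ 2 =
       frobenius_norm (row j YY - c 0 j *: row j XX) ^+ 2
         + w j * `|a - c 0 j| ^+ 2) ->
  forall A, is_minimizer Q (fun B => obj B) A <-> A = F *m diag_mx c *m F^t*.
Proof.
move=> QP Pc w0 residual A.
have obj_c (d : 'rV[C]_n) : (forall j, P (d 0 j)) ->
    obj (F *m diag_mx d *m F^t*) ^+ 2 =
      obj (F *m diag_mx c *m F^t*) ^+ 2 + \sum_j w j * `|d 0 j - c 0 j| ^+ 2.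
  move=> Pd; rewrite !obj_unitary_diag -big_split; apply: eq_bigr => j _.
  exact: residual.
have term_ge0 (d : 'rV[C]_n) j : 0 <= w j * `|d 0 j - c 0 j| ^+ 2.
  by rewrite mulr_ge0 ?exprn_ge0 ?(ltW (w0 j)).
have Qc : Q (F *m diag_mx c *m F^t*) by apply/QP; exists c.
split=> [[/QP[d Pd ->] min_d]|->].
  (* Uniqueness: the excess is both nonpositive and a sum of nonnegative terms, so each term
     vanishes. *)
  congr (_ *m diag_mx _ *m _); apply/rowP=> j.
  have := min_d _ Qc; rewrite -ler_sqr ?nnegrE ?frobenius_norm_ge0 //.
  rewrite obj_c // gerDl => sum_le0.
  have /eqP : \sum_j w j * `|d 0 j - c 0 j| ^+ 2 = 0.
    by apply/le_anti; rewrite sum_le0 sumr_ge0.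
  rewrite psumr_eq0 // => /allP /(_ j (mem_index_enum j)) /=.
  rewrite mulf_eq0 gt_eqF //= expf_eq0 normr_eq0 subr_eq0 /=.
  by move/eqP.
split=> // B /QP[d Pd ->].
rewrite -ler_sqr ?nnegrE ?frobenius_norm_ge0 // [leRHS]obj_c // lerDl.
by rewrite sumr_ge0.
Qed.

Lemma trmxC_unitary_diag (d : 'rV[C]_n) :
  (F *m diag_mx d *m F^t*)^t* = F *m diag_mx (map_mx Num.conj d) *m F^t*.
Proof.
by rewrite !trmx_mul !map_mxM /= trmxCK tr_diag_mx map_diag_mx mulmxA.
Qed.

(** Serves to turn the matrix equations [A = A^t*] and [A = - A^t*] into conditions on each
    eigenvalue. *)
Lemma unitary_diag_inj : injective (fun d : 'rV[C]_n => F *m diag_mx d *m F^t*).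
Proof.
move=> d e /(congr1 (fun M => F^t* *m M *m F)).
rewrite !mulmxA !tC_F !mul1mx -!mulmxA tC_F !mulmx1 => /matrixP de.
by apply/rowP=> j; have := de j j; rewrite !mxE eqxx.
Qed.

Lemma unitary_diag_unitarymx (d : 'rV[C]_n) :
  F *m diag_mx d *m F^t* \is unitarymx <-> forall j, `|d 0 j| = 1.
Proof.
have -> : (F *m diag_mx d *m F^t* \is unitarymx) = (diag_mx d \is unitarymx).
  apply/idP/idP => [U|U]; last by rewrite !mul_unitarymx ?trmxC_unitary.
  have -> : diag_mx d = F^t* *m (F *m diag_mx d *m F^t*) *m F.
    by rewrite !mulmxA tC_F mul1mx -mulmxA tC_F mulmx1.
  by apply: mul_unitarymx => //; apply: mul_unitarymx; rewrite ?trmxC_unitary.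
have entry j k : (diag_mx d *m (diag_mx d)^t*) j k = `|d 0 j| ^+ 2 *+ (j == k).
  rewrite tr_diag_mx map_diag_mx mulmx_diag !mxE normCK.
  by case: eqP => // <-; rewrite !mulr1n.
split=> [/unitarymxP/matrixP U j|U].
  have := U j j; rewrite entry !mxE eqxx => /eqP.
  by rewrite mulr1n pexpr_eq1 // => /eqP.
by apply/unitarymxP/matrixP=> j k; rewrite entry U expr1n !mxE.
Qed.

(** * The three constrained circulant problems *)

Hypothesis circulantP : forall A : 'M[C]_n,
  circulant A <-> exists d : 'rV[C]_n, A = F *m diag_mx d *m F^t*.

Local Notation yx j := ((row j YY *m (row j XX)^t*) 0 0).

Lemma circulant_hermitian_minimizer :
  (forall j, row j XX != 0) ->
  forall A, is_minimizer (fun B => circulant B /\ B = B^t*) (fun B => obj B) A <->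
    A = F *m diag_mx (\row_j ('Re (yx j) / frobenius_norm (row j XX) ^+ 2)) *m F^t*.
Proof.
move=> X0; set c := \row_j _.
have real_c j : c 0 j \is Num.real.
  by rewrite mxE rpred_div ?Creal_Re // ger0_real ?exprn_ge0 ?frobenius_norm_ge0.
apply: (is_minimizer_unitary_diag (P := fun a => a \is Num.real)
          (w := fun j => frobenius_norm (row j XX) ^+ 2)) => // [A|j|j a real_a].
- split=> [[/circulantP[d ->]]|[d real_d ->]].
    rewrite trmxC_unitary_diag => /unitary_diag_inj dd; exists d => // j.
    by rewrite CrealE {2}dd !mxE.
  split; first by apply/circulantP; exists d.
  rewrite trmxC_unitary_diag; congr (_ *m diag_mx _ *m _).
  by apply/rowP=> j; rewrite mxE conj_Creal.
- exact: frobenius_norm_row_gt0.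
have w0 := lt0r_neq0 (frobenius_norm_row_gt0 (X0 j)).
have cE : c 0 j = (yx j + (yx j)^*) / 2 / frobenius_norm (row j XX) ^+ 2.
  by rewrite mxE ReE.
rewrite !frobenius_norm_subZ normCK rmorphB /= (conj_Creal real_a) (conj_Creal (real_c j)).
(* With real and imaginary parts eliminated, the identity is a rational one in which [yx j] and its
   conjugate can be independent variables [s] and [t]. *)
rewrite cE; move: (yx j) (_ ^* ) (frobenius_norm _ ^+ 2) (frobenius_norm _ ^+ 2) w0 => s t ny nx nx0.
by field.
Qed.

Lemma circulant_skew_hermitian_minimizer :
  (forall j, row j XX != 0) ->
  forall A, is_minimizer (fun B => circulant B /\ B = - B^t*) (fun B => obj B) A <->
    A = F *m diag_mx (\row_j ('i * 'Im (yx j) / frobenius_norm (row j XX) ^+ 2))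
          *m F^t*.
Proof.
move=> X0; set c := \row_j _.
have conj_w j : (frobenius_norm (row j XX) ^+ 2)^* = frobenius_norm (row j XX) ^+ 2.
  by rewrite conj_Creal // ger0_real ?exprn_ge0 ?frobenius_norm_ge0.
have conj_c j : (c 0 j)^* = - c 0 j.
  rewrite mxE !rmorphM fmorphV /= conj_w conjCi (conj_Creal (Creal_Im _)).
  by rewrite !mulNr.
apply: (is_minimizer_unitary_diag (P := fun a => a^* = - a)
          (w := fun j => frobenius_norm (row j XX) ^+ 2)) => // [A|j|j a conj_a].
- split=> [[/circulantP[d ->]]|[d conj_d ->]].
    (* The sign is moved into the diagonal factor so that injectivity applies. *)
    rewrite trmxC_unitary_diag -mulNmx -mulmxN -linearN => /unitary_diag_inj dd.
    by exists d => // j; rewrite {2}dd !mxE opprK.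
  split; first by apply/circulantP; exists d.
  rewrite trmxC_unitary_diag -mulNmx -mulmxN -linearN.
  by congr (_ *m diag_mx _ *m _); apply/rowP=> j; rewrite !mxE conj_d opprK.
- exact: frobenius_norm_row_gt0.
have w0 := lt0r_neq0 (frobenius_norm_row_gt0 (X0 j)).
rewrite !frobenius_norm_subZ normCK rmorphB /= conj_c conj_a.
have cE : c 0 j = (yx j - (yx j)^*) / 2 / frobenius_norm (row j XX) ^+ 2.
  by rewrite mxE ImE !mulrA mulCii mulN1r opprB.
rewrite cE; move: (yx j) (_ ^* ) (frobenius_norm _ ^+ 2) (frobenius_norm _ ^+ 2) w0 => s t ny nx nx0.
by field.
Qed.

(** On the unit circle the quadratic term is constant, so only the cross term varies. Writing
    [yx j = t * c] with [t] its modulus, minus the cross term is [t * (|a - c|^2 - 2)], whence the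
    weight [t]. *)
Lemma circulant_unitary_minimizer :
  (forall j, yx j != 0) ->
  forall A,
    is_minimizer (fun B => circulant B /\ B \is unitarymx) (fun B => obj B) A <->
    A = F *m diag_mx (\row_j (yx j / `|yx j|)) *m F^t*.
Proof.
move=> yx0; set c := \row_j _.
have norm_c j : `|c 0 j| = 1.
  by rewrite mxE normf_div normr_id divff ?normr_eq0.
apply: (is_minimizer_unitary_diag (P := fun a => `|a| = 1)
          (w := fun j => `|yx j|)) => // [A|j|j a norm_a].
- split=> [[/circulantP[d ->]] /unitary_diag_unitarymx|[d norm_d ->]].
    by exists d.
  by split; [apply/circulantP; exists d | apply/unitary_diag_unitarymx].
- by rewrite normr_gt0.
have norm0 : `|yx j| != 0 by rewrite normr_eq0.
have cE : yx j = `|yx j| * c 0 j by rewrite [c 0 j]mxE mulrC divfK.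
rewrite !frobenius_norm_subZ normCK rmorphB /=.
have := normCK a; have := normCK (c 0 j); rewrite norm_a norm_c expr1n => cc aa.
have conj_t : `|yx j|^* = `|yx j| by rewrite conj_normC.
move: cE conj_t; move: `|yx j| => t -> conj_t.
rewrite rmorphM /= conj_t.
move: (esym aa) (esym cc); move: (c 0 j) (_ ^* ) (_ ^* ) => u v z za vu.
(* The conjugates [z] of [a] and [v] of [u] are free variables subject only to [a * z = 1] and
   [u * v = 1]. *)
ring: za vu.
Qed.

End UnitarilyDiagonalLeastSquares.

(** * The complex exponential as a primitive root of unity *)

Lemma expr_cis (R : realType) (t : R) k : cis t ^+ k = cis (t *+ k).
Proof.
elim: k => [|k IHk]; first by rewrite expr0 mulr0n /cis cos0 sin0.
by rewrite exprS IHk mulrS /cis cosD sinD; simpc; rewrite [X in (_ +i* X)%C]addrC.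
Qed.

(** The real part suffices: [cos t = 1] would force [sin (t / 2) = 0], although [t / 2] lies
    strictly between 0 and [pi]. *)
Lemma cis_neq1 (R : realType) (t : R) : 0 < t < pi *+ 2 -> cis t != 1.
Proof.
move=> /andP[t0 t2]; apply/negP=> /eqP[/eqP].
have -> : t = (t / 2) *+ 2 by rewrite -mulr_natr divfK ?pnatr_eq0.
rewrite cos_mulr2n => cos1 _.
have s0 : 0 < sin (t / 2).
  by apply: sin_gt0_pi; rewrite divr_gt0 //= ltr_pdivrMr // mulr_natr.
have := cos2Dsin2 (t / 2); have := exprn_gt0 2 s0; move/eqP: cos1; lra.
Qed.

Lemma prim_root_cis (R : realType) n :
  (0 < n)%N -> n.-primitive_root (cis (pi *+ 2 / n%:R) : R[i]).
Proof.
move=> n0; have nR0 : n%:R != 0 :> R by rewrite pnatr_eq0 -lt0n.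
apply/andP; split=> //; apply/forallP=> k; rewrite unity_rootE expr_cis.
have [->|kn] := eqVneq k.+1 n.
  by rewrite -[_ *+ n]mulr_natr divfK // /cis cos2pi sin2pi !eqxx.
rewrite eqbF_neg; apply: cis_neq1.
have lt_kn : (k.+1 < n)%N by rewrite ltn_neqAle kn /=.
have pi2 : 0 < pi *+ 2 :> R by rewrite pmulrn_lgt0 // pi_gt0.
rewrite -[_ *+ k.+1]mulr_natr mulrAC divr_gt0 ?mulr_gt0 ?ltr0n //=.
by rewrite ltr_pdivrMr ?ltr0n // ltr_pM2l // ltr_nat.
Qed.

Lemma dft_mx_cis (R : realType) n :
  dft_mx R n = root_dft_mx n (cis (pi *+ 2 / n%:R)).
Proof.
apply/matrixP=> j k; rewrite !mxE expr_cis; congr (cis _ / _).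
by rewrite -[RHS]mulr_natr -(mulr_natl pi) mulrAC.
Qed.

Lemma dft_mx_unitary (R : realType) n : dft_mx R n \is unitarymx.
Proof.
(* There is no primitive root of order 0, so the empty matrix is treated apart, here and in the next
   lemma. *)
case: n => [|n]; last by rewrite dft_mx_cis root_dft_mx_unitary // prim_root_cis.
by apply/unitarymxP; rewrite [LHS]flatmx0 [RHS]flatmx0.
Qed.

Lemma circulant_dft_mx (R : realType) n (A : 'M[R[i]]_n) :
  circulant A <->
  exists d : 'rV[R[i]]_n, A = dft_mx R n *m diag_mx d *m (dft_mx R n)^t*.
Proof.
case: n A => [|n] A; last first.
  by rewrite dft_mx_cis; apply/circulant_root_dft_mx/prim_root_cis.
split=> _; first by exists 0; rewrite [LHS]flatmx0 [RHS]flatmx0.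
by exists [tuple] => -[].
Qed.

Theorem mainTheorem2 (R : realType) (n m : nat) (X Y : 'M[R[i]]_(n, m)) :
  let F : 'M[R[i]]_n := dft_mx R n in
  let XX : 'M[R[i]]_(n, m) := F^t* *m X in
  let YY : 'M[R[i]]_(n, m) := F^t* *m Y in
  let yx (j : 'I_n) : R[i] := (row j YY *m (row j XX)^t*) 0 0 in
  let obj (A : 'M[R[i]]_n) : R[i] := frobenius_norm (Y - A *m X) in
  [/\ (forall j : 'I_n, row j XX != 0) ->
      forall A : 'M[R[i]]_n,
        is_minimizer (fun B => circulant B /\ B = B^t*) obj A <->
        A = F *m diag_mx (\row_j ('Re (yx j) / frobenius_norm (row j XX) ^+ 2))
              *m F^t*,
      (forall j : 'I_n, row j XX != 0) ->
      forall A : 'M[R[i]]_n,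
        is_minimizer (fun B => circulant B /\ B = - B^t*) obj A <->
        A = F *m diag_mx
                   (\row_j ('i * 'Im (yx j) / frobenius_norm (row j XX) ^+ 2))
              *m F^t*
    & (forall j : 'I_n, yx j != 0) ->
      forall A : 'M[R[i]]_n,
        is_minimizer (fun B => circulant B /\ B \is unitarymx) obj A <->
        A = F *m diag_mx (\row_j (yx j / `|yx j|)) *m F^t*].
Proof.
split.
- exact: circulant_hermitian_minimizer (dft_mx_unitary R n) (@circulant_dft_mx R n).
- exact: circulant_skew_hermitian_minimizer (dft_mx_unitary R n) (@circulant_dft_mx R n).
- exact: circulant_unitary_minimizer (dft_mx_unitary R n) (@circulant_dft_mx R n).
Qed.
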